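(* Let $n \in \mathbb{N}$, $n\ge 1$, let $t_0 \in \mathbb{R}$ and $y_0 \in \mathbb{R}^n$, and let $f:\mathrm{Dom}(f) \subset \mathbb{R}^{n+1} \to \mathbb{R}^n$ be a function defined in a neighborhood of $(t_0,y_0)$. If $f$ is continuous in a neighborhood of $(t_0,y_0)$, then the initial value problem $$y'=f(t,y), \quad y(t_0)=y_0,$$ has at least one solution defined in a neighborhood of $t_0$.
   Context: A solution of the initial value problem $y'=f(t,y)$, $y(t_0)=y_0$ is a function $\varphi:I \to \mathbb{R}^n$ which is differentiable in a nondegenerate real interval $I$ with $t_0 \in I$, such that $\varphi(t_0)=y_0$, $(t,\varphi(t)) \in \mathrm{Dom}(f)$ and $\varphi'(t)=f(t,\varphi(t))$ for all $t \in I$, where the corresponding one-sided derivatives are considered at the endpoints of the interval belonging to $I$. *)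

(* Defs.v *)
From HB Require Import structures.
From mathcomp Require Import all_boot all_order all_algebra.
From mathcomp Require Import all_classical all_reals all_analysis.
Set Implicit Arguments.
Unset Strict Implicit.
Unset Printing Implicit Defensive.
Import Order.TTheory GRing.Theory Num.Theory.
Import numFieldNormedType.Exports.
Local Open Scope classical_set_scope.
Local Open Scope ring_scope.

Definition nondegenerate_interval (R : realType) (I : set R) : Prop :=
  is_interval I /\ exists a b : R, [/\ I a, I b & a < b].

(* The increment h is restricted to nonzero values with h + t \in I. Hence this
   is the ordinary derivative when t is interior to I, and the one-sided
   derivative when t is an endpoint belonging to the nondegenerate interval I. *)
Definition has_derivative_in (R : realType) (V : normedModType R) (I : set R)
    (phi : R -> V) (t : R) (v : V) : Prop :=
  h^-1 *: (phi (h + t) - phi t) @[h --> within [set h | I (h + t)] 0^'] --> v.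

(* A partial function f : Dom(f) -> R^n with Dom(f) a subset of R^(n+1) is given
   by its domain D, a subset of R * R^n, and a total function f whose values
   outside D are irrelevant; likewise only the values of phi on I matter. *)
Definition is_solution (R : realType) (n : nat) (D : set (R * 'rV[R]_n))
    (f : R * 'rV[R]_n -> 'rV[R]_n) (t0 : R) (y0 : 'rV[R]_n)
    (I : set R) (phi : R -> 'rV[R]_n) : Prop :=
  [/\ nondegenerate_interval I,
      I t0,
      phi t0 = y0 &
      forall t, I t ->
        D (t, phi t) /\ has_derivative_in I phi t (f (t, phi t))].

(* Main.v *)
Require Import Defs.
From HB Require Import structures.
From mathcomp Require Import all_boot all_order all_algebra.
From mathcomp Require Import all_classical all_reals all_analysis.
From mathcomp Require Import ring lra.
Import Order.TTheory GRing.Theory Num.Theory.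
Import numFieldNormedType.Exports.
Local Open Scope classical_set_scope.
Local Open Scope ring_scope.

(** On a small ball around (t0, y0) the function f is continuous and bounded;
    let g be f cut off to 0 outside. The Euler scheme with mesh 1/(k+1), read as a step
    function of time, stays in a bounded set at every fixed time, so it converges
    pointwise along a free ultrafilter on the indices k. No equicontinuity or
    uniform convergence is needed: if g is within e of c near (t, phi t), then the
    Euler increments over a short interval [a, b] containing t are within
    e (b - a) + O(mesh) of c (b - a), an inequality between two values of the step
    function that passes to the limit, and it says that phi' t = g (t, phi t).
    Backward time is the same statement for the reflected field. *)

(** * Increments of the Euler scheme *)

Section Euler.
Context {R : realType} {V : normedModType R}.
Implicit Types (g : R * V -> V) (h : R) (x c : V).

Fixpoint euler g h x (l : nat) : V :=
  if l is l'.+1 then euler g h x l' + h *: g (l'%:R * h, euler g h x l')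
  else x.

(** The increment telescopes into the terms [h *: g (...)] for [i <= l < j], and each of them is
    within [h * r] of [h *: c]. *)
Lemma euler_increment g h x c (r : R) (i j : nat) : 0 <= h -> (i <= j)%N ->
  (forall l, (i <= l < j)%N -> `|g (l%:R * h, euler g h x l) - c| <= r) ->
  `|euler g h x j - euler g h x i - (j%:R * h - i%:R * h) *: c|
    <= (j%:R * h - i%:R * h) * r.
Proof.
move=> h0; elim: j => [|j IH].
  by rewrite leqn0 => /eqP -> _; rewrite !subrr scale0r subrr normr0 mul0r.
rewrite leq_eqVlt => /predU1P[-> _|].
  by rewrite !subrr scale0r subrr normr0 mul0r.
rewrite ltnS => ij gc.
have {}IH := IH ij _.
have gj : `|g (j%:R * h, euler g h x j) - c| <= r by apply: gc; rewrite ij /=.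
have -> : euler g h x j.+1 - euler g h x i - (j.+1%:R * h - i%:R * h) *: c =
    (euler g h x j - euler g h x i - (j%:R * h - i%:R * h) *: c)
    + h *: (g (j%:R * h, euler g h x j) - c).
  rewrite /= -natr1 mulrDl mul1r (addrAC (j%:R * h)) (scalerDl c _ h) scalerBr opprD.
  by rewrite (addrAC (euler g h x j)) addrACA.
apply: (le_trans (ler_normD _ _)).
rewrite -natr1 (mulrDl _ _ h) mul1r (addrAC (j%:R * h)) (mulrDl _ h r).
apply: lerD.
  by apply: IH => l /andP[il lj]; apply: gc; rewrite il ltnS (ltnW lj).
by rewrite normrZ ger0_norm// ler_wpM2l.
Qed.

(** This is [euler_increment] with [c = 0] and [r = M]; the absolute value of the elapsed time makes
    it usable for indices in either order. *)
Lemma euler_lipschitz g h x (M : R) (i j : nat) : 0 <= h ->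
  (forall p, `|g p| <= M) ->
  `|euler g h x j - euler g h x i| <= `|j%:R * h - i%:R * h| * M.
Proof.
move=> h0 gM; wlog ij : i j / (i <= j)%N.
  move=> W; case/orP: (leq_total i j) => /W// W'.
  by rewrite distrC (distrC (_ * _)).
have := @euler_increment g h x 0 M i j h0 ij.
rewrite scaler0 subr0 => /(_ _)/le_trans; apply.
  by move=> l _; rewrite subr0.
by rewrite ger0_norm// -mulrBl mulr_ge0// subr_ge0 ler_nat.
Qed.

End Euler.

(** * Time grids of mesh tending to 0 *)

Section Grid.
Context {R : realType}.
Implicit Types (t s : R) (k : nat).

Definition mesh k : R := k.+1%:R^-1.

Definition grid_index k t : nat := Num.truncn (t / mesh k).

Definition grid_floor k t : R := (grid_index k t)%:R * mesh k.

Lemma mesh_gt0 k : 0 < mesh k. Proof. by rewrite invr_gt0. Qed.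

Lemma cvg_mesh : mesh @ \oo --> (0 : R). Proof. exact: cvg_harmonic. Qed.

Lemma grid_floor_le k t : 0 <= t -> grid_floor k t <= t.
Proof.
move=> t0; have h0 := mesh_gt0 k.
have /andP[ge _] := truncn_itv (divr_ge0 t0 (ltW h0)).
by rewrite /grid_floor -ler_pdivlMr.
Qed.

Lemma grid_floor_gt k t : 0 <= t -> t - mesh k < grid_floor k t.
Proof.
move=> t0; have h0 := mesh_gt0 k.
have /andP[_ lt] := truncn_itv (divr_ge0 t0 (ltW h0)).
rewrite /grid_floor ltrBlDr -[X in _ + X]mul1r -mulrDl natr1.
by rewrite -ltr_pdivrMr.
Qed.

Lemma grid_index_le k : {homo grid_index k : s t / s <= t >-> (s <= t)%N}.
Proof.
move=> s t st; apply: le_truncn.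
by rewrite ler_pM2r// invr_gt0 mesh_gt0.
Qed.

Lemma grid_index0 k : grid_index k 0 = 0%N.
Proof. by rewrite /grid_index mul0r truncn0. Qed.
End Grid.

(** Closed balls of R^n are compact, so the image of the ultrafilter has a cluster point, and an
    ultrafilter converges to each of its cluster points. *)
Lemma bounded_ultra_cvg {R : realType} {n : nat} (U : set_system nat)
    (u : nat -> 'rV[R]_n) (C : R) : UltraFilter U -> (forall k, `|u k| <= C) ->
  exists l : 'rV[R]_n, u @ U --> l.
Proof.
move=> UU uC.
have B : bounded_set [set x : 'rV[R]_n | `|x| <= C].
  exists C; split; first by rewrite num_real.
  by move=> x Cx y /= /le_trans; apply; exact: ltW.
have K : closed [set x : 'rV[R]_n | `|x| <= C].
  rewrite (_ : [set _ | _] = closed_ball_ Num.norm (0:'rV[R]_n) C); last first.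
    by apply/seteqP; split => x; rewrite /closed_ball_ /= sub0r normrN.
  exact: closed_closed_ball_.
have [|l [_ ul]] := bounded_closed_compact B K (F := u @ U).
  exact: nearW.
(* Otherwise the complement of [A] would belong to [u @ U] and so would have to meet the
   neighborhood [A] of the cluster point [l]. *)
exists l => A Al; have [//|UA] := in_ultra_setVsetC (u @^-1` A) UU.
by have [y []] := ul (~` A) A UA Al.
Qed.

(** * The Euler scheme as a step function of time *)

Definition euler_step {R : realType} {V : normedModType R} (g : R * V -> V)
  (x : V) (k : nat) (t : R) : V := euler g (mesh k) x (grid_index k t).

Section EulerStep.
Context {R : realType} {V : normedModType R}.
Context (g : R * V -> V) (x : V) (M : R) (gM : forall p, `|g p| <= M).

Lemma euler_step_bound k (t : R) : 0 <= t -> `|euler_step g x k t - x| <= M * t.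
Proof.
move=> t0; have := @euler_lipschitz _ _ g _ x M 0 (grid_index k t) (ltW (mesh_gt0 k)) gM.
move/le_trans; apply; rewrite mul0r subr0 mulrC ler_wpM2l//.
  by rewrite (le_trans _ (gM (0, 0))).
by rewrite ger0_norm ?grid_floor_le// mulr_ge0// ltW// mesh_gt0.
Qed.

(** Closeness to [z] is assumed at the single time [t]: the Lipschitz bound carries it to all nodes
    used between [a] and [b], where [euler_increment] then applies. Replacing the elapsed grid time
    by [b - a] costs at most [mesh k * |c|]. *)
Lemma euler_step_increment (c z : V) (e eta a b t : R) k :
    0 <= a -> a <= t <= b ->
    (forall u y, `|u - t| < eta -> `|y - z| < eta -> `|g (u, y) - c| <= e) ->
    b - a + mesh k < eta ->
    `|euler_step g x k t - z| + M * (b - a + mesh k) < eta ->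
  `|euler_step g x k b - euler_step g x k a - (b - a) *: c|
    <= (b - a + mesh k) * e + mesh k * `|c|.
Proof.
move=> a0 /andP[a_t tb] gc eta1 eta2.
have h0 : 0 < mesh k :> R := mesh_gt0 k.
have M0 : 0 <= M by rewrite (le_trans _ (gM (0, 0))).
have t0 := le_trans a0 a_t; have b0 := le_trans t0 tb.
have Aa := grid_floor_le k _ a0; have Bb := grid_floor_le k _ b0.
have aA := grid_floor_gt k _ a0; have bB := grid_floor_gt k _ b0.
have ij := grid_index_le k _ _ (le_trans a_t tb).
have grid_mono i j : (i <= j)%N -> i%:R * mesh k <= j%:R * mesh k :> R.
  by move=> ?; rewrite ler_pM2r// ler_nat.
have AT : grid_floor k a <= grid_floor k t by apply/grid_mono/grid_index_le.
have TB : grid_floor k t <= grid_floor k b by apply/grid_mono/grid_index_le.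
have e0 : 0 <= e.
  apply: (le_trans (normr_ge0 _) (gc t z _ _)); rewrite subrr normr0; lra.
have inc := @euler_increment _ _ g (mesh k) x c e _ _ (ltW h0) ij.
have {}inc := inc _.
rewrite -!/(grid_floor _ _) -!/(euler_step _ _ _ _) in inc.
have {}inc : `|euler_step g x k b - euler_step g x k a
    - (grid_floor k b - grid_floor k a) *: c| <= (b - a + mesh k) * e.
  apply: le_trans (inc _) _; last by apply: ler_wpM2r => //; lra.
  move=> l /andP[il lj].
  have Al : grid_floor k a <= l%:R * mesh k by apply: grid_mono.
  have lB : l%:R * mesh k <= grid_floor k b by apply/grid_mono/ltnW.
  apply: gc; first by rewrite ltr_norml; apply/andP; split; lra.
  (* Pass through the value at [t]; both nodes lie between the grid points of [a] and [b], hence at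
     most [b - a + mesh k] apart. *)
  rewrite -(subrK (euler_step g x k t) (euler _ _ _ _)) -addrA.
  apply: le_lt_trans (ler_normD _ _) _.
  apply: le_lt_trans eta2; rewrite [leLHS]addrC lerD2l.
  have := euler_lipschitz g (mesh k) x M (grid_index k t) l (ltW h0) gM.
  move/le_trans; apply.
  rewrite -/(grid_floor _ _) mulrC ler_wpM2l// ler_norml; apply/andP; split; lra.
have -> : euler_step g x k b - euler_step g x k a - (b - a) *: c =
    (euler_step g x k b - euler_step g x k a
      - (grid_floor k b - grid_floor k a) *: c)
    + ((grid_floor k b - grid_floor k a) - (b - a)) *: c.
  by rewrite (scalerBl _ (b - a)) addrA subrK.
apply: le_trans (ler_normD _ _) _; rewrite lerD// normrZ ler_wpM2r//.
by rewrite ler_norml; apply/andP; split; lra.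
Qed.

End EulerStep.

(** * Passage to the limit, forward and backward in time *)

Lemma peano_right {R : realType} {n : nat} (g : R * 'rV[R]_n -> 'rV[R]_n)
    (x : 'rV[R]_n) (M : R) : (forall p, `|g p| <= M) ->
  exists phi : R -> 'rV[R]_n, [/\ phi 0 = x,
    forall t, 0 <= t -> `|phi t - x| <= M * t &
    forall t, 0 <= t -> {for (t, phi t), continuous g} ->
      forall e, 0 < e -> \forall s \near t, 0 <= s ->
        `|phi s - phi t - (s - t) *: g (t, phi t)| <= e * `|s - t|].
Proof.
move=> gM; have M0 : 0 <= M by rewrite (le_trans _ (gM (0, 0))).
(* [U] refines the filter of cofinal segments of the indices, so limits as k tends to infinity
   persist along [U]. *)
have [U [UU ooU]] := ultraFilterLemma (@eventually_filter).
have PU : ProperFilter U := @ultra_proper _ _ UU.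
have meshU : mesh @ U --> (0 : R) by move=> A /cvg_mesh/ooU.
(* The limit is chosen separately at each time; 0 is a default value for negative times. *)
have /choice[phi phiP] : forall t : R, exists l : 'rV[R]_n,
    0 <= t -> euler_step g x ^~ t @ U --> l.
  move=> t; have [t0|] := leP 0 t; last by exists 0.
  have [|l ul] := @bounded_ultra_cvg _ _ U (euler_step g x ^~ t)
    (`|x| + M * t) UU; last by exists l.
  move=> k; rewrite -(subrKC x (euler_step _ _ _ _)).
  by apply: le_trans (ler_normD _ _) _; rewrite lerD2l euler_step_bound.
have phi0 : phi 0 = x.
  have h := phiP 0 (lexx _).
  apply: (cvg_unique _ h) => //.
  rewrite (_ : euler_step g x ^~ 0 = cst x); first exact: cvg_cst.
  by apply/funext => k; rewrite /euler_step grid_index0.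
exists phi; split => //.
  move=> t t0; apply: (@ler_cvg_to _ U _ _ (fun k => `|euler_step g x k t - x|)
    (cst (M * t))).
  - by apply: cvg_norm; apply: cvgB; [exact: phiP|exact: cvg_cst].
  - exact: cvg_cst.
  - by apply: nearW => k; apply: euler_step_bound.
move=> t t0 gcont e e0.
have /nbhs_ballP[eta /= eta0 gnear] : \forall p \near (t, phi t),
    `|g p - g (t, phi t)| <= e.
  by move/cvgrPdist_le : gcont => /(_ e e0); apply: filterS => p; rewrite distrC.
have {}gnear u y : `|u - t| < eta -> `|y - phi t| < eta ->
    `|g (u, y) - g (t, phi t)| <= e.
  move=> ut yt; apply: (gnear (u, y)); split => /=.
    by rewrite -ball_normE /ball_ /= distrC.
  by rewrite -ball_normE /ball_ /= distrC.
(* Since the mesh tends to 0 and the scheme at [t] tends to [phi t], these strict bounds give those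
   of [euler_step_increment] for [U]-almost all k, and its conclusion passes to the limit. *)
have key a b : 0 <= a -> a <= t <= b -> b - a < eta -> M * (b - a) < eta ->
    `|phi b - phi a - (b - a) *: g (t, phi t)| <= (b - a) * e.
  move=> a0 /andP[a_t tb] ba Mba; have b0 := le_trans a0 (le_trans a_t tb).
  have lim1 : b - a + mesh k @[k --> U] --> b - a.
    by rewrite -[X in _ --> X]addr0; apply: cvgD => //; exact: cvg_cst.
  pose c := g (t, phi t).
  apply: (@ler_cvg_to _ U _ _
    (fun k => `|euler_step g x k b - euler_step g x k a - (b - a) *: c|)
    (fun k => (b - a + mesh k) * e + mesh k * `|c|)).
  - apply: cvg_norm; apply: cvgB; last exact: cvg_cst.
    by apply: cvgB; apply: phiP.
  - rewrite -[X in _ --> X]addr0 -[X in _ --> _ + X](mul0r `|c|).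
    by apply: cvgD; apply: cvgMr_tmp.
  - have near1 : \forall k \near U, b - a + mesh k < eta.
      exact: (cvgr_lt _ lim1).
    have near2 : \forall k \near U,
        `|euler_step g x k t - phi t| + M * (b - a + mesh k) < eta.
      have lim2 : `|euler_step g x k t - phi t| + M * (b - a + mesh k)
          @[k --> U] --> 0 + M * (b - a).
        apply: cvgD; last exact: cvgMl_tmp.
        rewrite -(@normr0 _ 'rV[R]_n) -(subrr (phi t)); apply: cvg_norm.
        by apply: cvgB; [exact: phiP|exact: cvg_cst].
      by apply: (cvgr_lt _ lim2); rewrite add0r.
    near=> k; apply: (@euler_step_increment _ _ g x M gM c (phi t) e eta a b t) => //.
    + by rewrite a_t.
    + by near: k.
    + by near: k.
(* This radius keeps both [|t - s|] and [M * |t - s|] below [eta], even when [M = 0]. The estimate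
   [key] is then used on [s, t] or [t, s]. *)
have d0 : 0 < eta / (M + 1) by rewrite divr_gt0// ltr_wpDl.
apply/nbhs_ballP; exists (eta / (M + 1)) => //= s.
rewrite -ball_normE /ball_ /= ltr_pdivlMr ?ltr_wpDl// => ts s0.
have ts1 : `|t - s| < eta.
  apply: le_lt_trans ts; rewrite ler_peMr//; lra.
have ts2 : M * `|t - s| < eta.
  apply: le_lt_trans ts; rewrite mulrC ler_wpM2l//; lra.
have [st|/ltW ts'] := leP s t.
  rewrite ger0_norm ?subr_ge0// in ts1 ts2.
  have := key s t s0; rewrite st lexx => /(_ isT ts1 ts2).
  rewrite -(opprB t s) -(opprB (phi t)) scaleNr -opprD !normrN.
  by rewrite (ger0_norm (_ : 0 <= t - s)) ?subr_ge0// (mulrC e).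
rewrite distrC ger0_norm ?subr_ge0// in ts1 ts2.
have := key t s t0; rewrite ts' lexx => /(_ isT ts1 ts2).
by rewrite (ger0_norm (_ : 0 <= s - t)) ?subr_ge0// (mulrC e).
Unshelve. all: by end_near.
Qed.

Lemma affine_time_continuous {R : realType} {V : normedModType R} (t0 s : R) :
  continuous (fun p : R * V => (t0 + s * p.1, p.2)).
Proof.
move=> p; apply: (@cvg_pair _ _ _ _ (nbhs (t0 + s * p.1)) (nbhs p.2)).
  apply: (@cvgD _ R^o); first exact: cvg_cst.
  by apply: cvgM; [exact: cvg_cst|exact: cvg_fst].
exact: cvg_snd.
Qed.

(* [sg] is 1 for the forward and -1 for the backward half-line. *)
Lemma peano_half_line {R : realType} {n : nat} (g : R * 'rV[R]_n -> 'rV[R]_n)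
    (t0 : R) (x : 'rV[R]_n) (M sg : R) :
  (forall p, `|g p| <= M) -> `|sg| = 1 ->
  exists phi : R -> 'rV[R]_n, [/\ phi t0 = x,
    forall t, 0 <= sg * (t - t0) -> `|phi t - x| <= M * `|t - t0| &
    forall t, 0 <= sg * (t - t0) -> {for (t, phi t), continuous g} ->
      forall e, 0 < e -> \forall s \near t, 0 <= sg * (s - t0) ->
        `|phi s - phi t - (s - t) *: g (t, phi t)| <= e * `|s - t|].
Proof.
move=> gM sg1.
have sgK t : t0 + sg * (sg * (t - t0)) = t.
  have -> : sg * (sg * (t - t0)) = sg ^+ 2 * (t - t0) by ring.
  by rewrite -real_normK ?num_real// sg1 expr1n mul1r subrKC.
(* The field in the time variable [sg * (t - t0)]; going back multiplies the derivative by [sg]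
   again, and [sg * sg = 1]. *)
pose g' p := sg *: g (t0 + sg * p.1, p.2).
have g'M p : `|g' p| <= M by rewrite normrZ sg1 mul1r.
have [phi [phi0 phiM phiD]] := @peano_right _ _ g' x M g'M.
exists (fun t => phi (sg * (t - t0))); split.
- by rewrite subrr mulr0.
- by move=> t t_t0; rewrite (le_trans (phiM _ t_t0))// -(ger0_norm t_t0) normrM sg1 mul1r.
move=> t t_t0 gc e e0.
have g'c : {for (sg * (t - t0), phi (sg * (t - t0))), continuous g'}.
  apply: continuousZl_tmp.
  apply: (@continuous_comp _ _ _ (fun p : R * 'rV[R]_n => (t0 + sg * p.1, p.2)) g).
    exact: affine_time_continuous.
  by rewrite /= sgK.
have H := phiD _ t_t0 g'c e e0.
have c : sg * (s - t0) @[s --> t] --> sg * (t - t0).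
  by apply: cvgMl_tmp; apply: cvgB; [exact: cvg_id|exact: cvg_cst].
apply: (@filterS _ (nbhs t) _ _ _ _ (c _ H)) => s /= /[apply].
rewrite /g' /= sgK -mulrBr opprB addrA subrK normrM sg1 mul1r.
rewrite scalerA mulrAC.
suff -> : sg * sg = 1 by rewrite mul1r.
by rewrite -expr2 -real_normK ?num_real// sg1 expr1n.
Qed.

Lemma peano_bounded {R : realType} {n : nat} (g : R * 'rV[R]_n -> 'rV[R]_n)
    (t0 : R) (x : 'rV[R]_n) (M : R) : (forall p, `|g p| <= M) ->
  exists phi : R -> 'rV[R]_n, [/\ phi t0 = x,
    forall t, `|phi t - x| <= M * `|t - t0| &
    forall t, {for (t, phi t), continuous g} ->
      forall e, 0 < e -> \forall s \near t,
        `|phi s - phi t - (s - t) *: g (t, phi t)| <= e * `|s - t|].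
Proof.
move=> gM.
have [phip [phip0 phipM phipD]] := @peano_half_line _ _ g t0 x M 1 gM (normr1 _).
have [phim [phim0 phimM phimD]] := @peano_half_line _ _ g t0 x M (-1) gM (normrN1 _).
(* The two halves agree at [t0], so [phi] coincides with each of them on its closed half-line. *)
pose phi t := if t0 <= t then phip t else phim t.
have phiR t : t0 <= t -> phi t = phip t by rewrite /phi => ->.
have phiL t : t <= t0 -> phi t = phim t.
  rewrite /phi; have [t0t tt0|//] := leP t0 t.
  by have -> : t = t0 by [apply/le_anti; rewrite tt0]; rewrite phip0 phim0.
have right t : t0 <= t -> {for (t, phi t), continuous g} ->
    forall e, 0 < e -> \forall s \near t, t0 <= s ->
        `|phi s - phi t - (s - t) *: g (t, phi t)| <= e * `|s - t|.
  move=> t0t; rewrite phiR// => gc e e0.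
  have := phipD t; rewrite mul1r subr_ge0 => /(_ t0t gc e e0).
  by apply: filterS => s; rewrite mul1r subr_ge0 => H t0s; rewrite phiR// H.
have left t : t <= t0 -> {for (t, phi t), continuous g} ->
    forall e, 0 < e -> \forall s \near t, s <= t0 ->
        `|phi s - phi t - (s - t) *: g (t, phi t)| <= e * `|s - t|.
  move=> tt0; rewrite phiL// => gc e e0.
  have := phimD t; rewrite mulN1r opprB subr_ge0 => /(_ tt0 gc e e0).
  by apply: filterS => s; rewrite mulN1r opprB subr_ge0 => H st0; rewrite phiL// H.
exists phi; split; first by rewrite phiR.
  move=> t; have [t0t|/ltW tt0] := leP t0 t.
    by rewrite phiR// phipM// mul1r subr_ge0.
  by rewrite phiL// phimM// mulN1r opprB subr_ge0.
(* Away from [t0], times near [t] stay on one side; at [t0] the two one-sided estimates together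
   cover a neighborhood. *)
move=> t gc e e0; have [tt0|t0t|tt0] := ltgtP t t0.
- near=> s; have : s <= t0 by apply: ltW; near: s; exact: lt_nbhsl.
  by near: s; exact: left (ltW tt0) gc e e0.
- near=> s; have : t0 <= s by apply: ltW; near: s; exact: lt_nbhsr.
  by near: s; exact: right (ltW t0t) gc e e0.
- near=> s; have [|/ltW] := leP t0 s.
    by near: s; apply: right gc e e0; rewrite tt0.
  by near: s; apply: left gc e e0; rewrite tt0.
Unshelve. all: by end_near.
Qed.

(** * Derivatives relative to an interval, and localization *)

(** Put [s = h + t] and divide by [|h|]; the resulting two-sided limit restricts to increments
    staying in [I]. *)
Lemma has_derivative_in_near {R : realType} {V : normedModType R} (I : set R)
    (phi : R -> V) (t : R) (v : V) :
  (forall e, 0 < e -> \forall s \near t,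
    `|phi s - phi t - (s - t) *: v| <= e * `|s - t|) ->
  has_derivative_in I phi t v.
Proof.
move=> H; rewrite /has_derivative_in; apply: cvg_within_filter.
apply/cvgrPdist_le => e e0.
have c : (fun h : R => h + t) @ 0 --> t.
  rewrite -[X in _ --> X]add0r; apply: cvgD; [exact: cvg_id|exact: cvg_cst].
have {}H := c _ (H e e0).
rewrite /= in H.
rewrite near_withinE; near=> h => /= h0.
have : `|phi (h + t) - phi t - (h + t - t) *: v| <= e * `|h + t - t| by near: h.
rewrite addrK distrC => H1.
rewrite -(@ler_pM2l _ `|h|) ?normr_gt0// -normrZ scalerBr scalerA mulfV// scale1r.
by rewrite mulrC.
Unshelve. all: by end_near.
Qed.

Theorem mainTheorem1 (R : realType) (n : nat) (hn : (1 <= n)%N)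
    (t0 : R) (y0 : 'rV[R]_n)
    (D : set (R * 'rV[R]_n)) (f : R * 'rV[R]_n -> 'rV[R]_n)
    (hD : nbhs (t0, y0) D)
    (hf : exists U : set (R * 'rV[R]_n),
      [/\ nbhs (t0, y0) U, U `<=` D & {within U, continuous f}]) :
  exists (I : set R) (phi : R -> 'rV[R]_n),
    nbhs t0 I /\ is_solution D f t0 y0 I phi.
Proof.
have [U [U0 UD fU]] := hf.
(* On an open set, continuity within the set is ordinary continuity at each point. *)
pose W : set (R * 'rV[R]_n) := interior U.
have oW : open W by exact: open_interior.
have W0 : nbhs (t0, y0) W by exact: nbhs_interior.
have fW p : W p -> {for p, continuous f}.
  have : {within W, continuous f}.
    by apply: continuous_subspaceW fU; exact: interior_subset.
  by rewrite continuous_open_subspace// => fin Wp; apply: fin; rewrite inE.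
(* Adding 1 makes [M] a bound for [f] near the initial point, by continuity, and also gives
   [M >= 1]. *)
pose M := `|f (t0, y0)| + 1.
have fM : \forall p \near (t0, y0), `|f p| <= M.
  have /cvg_norm/cvgr_le := fW _ (nbhs_singleton W0); apply.
  by rewrite ltrDl.
have /nbhs_ballP[d /= d0 dP] : \forall p \near (t0, y0), W p /\ `|f p| <= M.
  exact: filterI W0 fM.
pose B : set (R * 'rV[R]_n) := ball (t0, y0) d.
(* The cutoff is bounded everywhere, and it is continuous at each point of the open ball [B], where
   it agrees with [f]. *)
pose g (p : R * 'rV[R]_n) := if p \in B then f p else 0.
have gM p : `|g p| <= M.
  rewrite /g; case: ifPn => [|_]; first by rewrite inE => /dP[].
  by rewrite normr0 addr_ge0.
have gf p : B p -> g p = f p by move=> Bp; rewrite /g mem_set.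
have gc p : B p -> {for p, continuous g}.
  move=> Bp; suff : g @ p --> f p by rewrite -gf.
  have := fW _ (dP _ Bp).1; apply: cvg_trans; apply: near_eq_cvg.
  have : nbhs p B by apply: open_nbhs_nbhs; split => //; exact: ball_open.
  by apply: filterS => q Bq; rewrite gf.
have [phi [phi0 phiM phiD]] := @peano_bounded _ _ g t0 y0 M gM.
have M1 : 1 <= M by rewrite lerDr.
have M0 : 0 < M by lra.
(* For [|t - t0| < a], the bound [M * |t - t0| < d] keeps [phi t] within [d] of [y0], and [M >= 1]
   keeps [t] within [d] of [t0]; the graph stays in [B]. *)
pose a := d / M.
have a0 : 0 < a by rewrite divr_gt0.
exists (ball t0 a), phi; split; first exact: nbhsx_ballx.
have phiB t : ball t0 a t -> B (t, phi t).
  rewrite /ball /= distrC ltr_pdivlMr// => ta; split; rewrite -ball_normE /ball_ /=.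
    by rewrite distrC; apply: le_lt_trans ta; rewrite ler_peMr.
  by rewrite distrC; apply: le_lt_trans ta; rewrite mulrC phiM.
split => //; [split| |].
- rewrite ball_itv; exact: interval_is_interval.
- exists t0, (t0 + a / 2); split; [exact: ballxx| |lra].
  rewrite /ball /= opprD addNKr normrN ger0_norm; lra.
- exact: ballxx.
- move=> t /phiB Bt; split.
    by have [Wt _] := dP _ Bt; apply: UD; exact: interior_subset Wt.
  rewrite -gf//; apply: has_derivative_in_near => e e0.
  exact: phiD (gc _ Bt) _ e0.
Qed.
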